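(* Let $E$ and $F$ be vector spaces over $\mathbb{K}$, where $\mathbb{K}=\mathbb{R}$ or $\mathbb{K}=\mathbb{C}$, let $m,n_1,\ldots,n_m$ be positive integers, and put $M:=\sum_{j=1}^m n_j$. Then $$\mathcal{P}_a(^{n_1,\ldots,n_m}E;F)\subset\mathcal{P}_a(^{M}E^m;F),$$ that is, every $(n_1,\ldots,n_m)$-homogeneous polynomial $P:E^m\to F$ is an $M$-homogeneous polynomial on the vector space $E^m$.
   Context: A map $Q:G\to F$ between vector spaces over $\mathbb{K}$ is an $n$-homogeneous polynomial if there is an $n$-linear mapping $A:G^n\to F$ with $Q(x)=A(x,\ldots,x)$ for every $x\in G$; $\mathcal{P}_a(^{n}G;F)$ is the vector space of all such maps. For positive integers $m,n_1,\ldots,n_m$, a mapping $P:E^m\to F$ is an $(n_1,\ldots,n_m)$-homogeneous polynomial (multipolynomial) if for each $1\le j\le m$ and all fixed $x_i\in E$ ($i\ne j$) the mapping $P(x_1,\ldots,x_{j-1},\cdot,x_{j+1},\ldots,x_m):E\to F$ is an $n_j$-homogeneous polynomial; $\mathcal{P}_a(^{n_1,\ldots,n_m}E;F)$ is the vector space of all such mappings. No continuity is required. $E^m$ carries the componentwise vector space structure. *)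

(* Defs.v *)
From mathcomp Require Import all_boot all_algebra.
From mathcomp Require Import reals.
From mathcomp Require Import complex.

Set Implicit Arguments.
Unset Strict Implicit.
Unset Printing Implicit Defensive.

Import GRing.Theory.
Local Open Scope ring_scope.

(* A power G^n is {ffun 'I_n -> G}, with its pointwise module structure.      *)

Definition update (n : nat) (G : Type) (x : {ffun 'I_n -> G}) (j : 'I_n)
    (t : G) : {ffun 'I_n -> G} :=
  finfun [eta x with j |-> t].

Definition multilinear (K : fieldType) (n : nat) (G F : lmodType K)
    (A : {ffun 'I_n -> G} -> F) : Prop :=
  forall (j : 'I_n) (x : {ffun 'I_n -> G}), linear (fun t => A (update x j t)).

Definition homogeneous_polynomial (K : fieldType) (n : nat) (G F : lmodType K)
    (Q : G -> F) : Prop :=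
  exists2 A : {ffun 'I_n -> G} -> F,
    multilinear A & forall x : G, Q x = A [ffun=> x].

(* The coordinate x j is irrelevant, being overwritten by update.             *)
Definition multipolynomial (K : fieldType) (m : nat) (n : 'I_m -> nat)
    (E F : lmodType K) (P : {ffun 'I_m -> E} -> F) : Prop :=
  forall (j : 'I_m) (x : {ffun 'I_m -> E}),
    homogeneous_polynomial (n j) (fun t => P (update x j t)).

(* Main.v *)
(* An n-homogeneous polynomial Q(x) = A(x, ..., x) is recovered from its        *)
(* polarization, the sum over S of (-1)^|S| Q(sum_(k in S) y_k): expanding A,   *)
(* only the terms indexed by bijections survive the alternating sum, so it is   *)
(* n-linear in y, and on the diagonal it equals (-1)^n n! Q.  Unlike A, it is   *)
(* linear in Q, so for a multipolynomial P one can polarize all coordinates at  *)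
(* once: split the M indices into blocks of sizes n_j and take the sum over     *)
(* S of (-1)^|S| P(j |-> sum of the j-th coordinates of X_k, k in S in the j-th *)
(* block).  It is M-linear in X : (E^m)^M and a nonzero multiple of P on the    *)
(* diagonal.                                                                    *)

Require Import Defs.
From HB Require Import structures.
From mathcomp Require Import all_boot all_order all_algebra.
From mathcomp Require Import reals.
From mathcomp Require Import complex.

Set Implicit Arguments.
Unset Strict Implicit.
Unset Printing Implicit Defensive.

Import GRing.Theory.
Local Open Scope ring_scope.

(** The multilinear maps witnessing homogeneity in one coordinate are chosen separately for each
    value of the others, so they cannot simply be composed; the explicit formula [polar] avoids the
    choice. [polar_expand] gives its linearity and diagonal value. [block_polarU1] isolates one
    block as an ordinary polarization with the other coordinates frozen: applied to the block of the
    varied index it yields [block_polar_linear], iterated over all blocks it yields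
    [block_polar_diag]. Dividing by the diagonal constant, nonzero in characteristic 0, gives the
    required form. *)

Lemma updateE n (G : Type) (x : {ffun 'I_n -> G}) j t i :
  update x j t i = if i == j then t else x i.
Proof. by rewrite ffunE. Qed.

Lemma big_pfamily_cons n (I : finType) (V : nmodType) (r : seq 'I_n) (i0 : 'I_n)
    (k0 : I) (Q : pred I) (h : {ffun 'I_n -> I} -> V) :
  i0 \notin r ->
  \sum_(f in pfamily k0 (mem (i0 :: r)) (fun=> Q)) h f =
  \sum_(f in pfamily k0 (mem r) (fun=> Q)) \sum_(k | Q k) h (update f i0 k).
Proof.
move=> nri; rewrite exchange_big /=.
rewrite (partition_big (fun f : {ffun 'I_n -> I} => f i0) Q) => [|f]; last first.
  by move/familyP/(_ i0); rewrite /= inE /= eqxx.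
apply: eq_bigr => k Qk.
(* Off [r] a function takes the default [k0], so resetting [i0] to [k0] inverts the update. *)
rewrite (reindex_onto (fun f => update f i0 k)
           (fun f => update f i0 k0)); last first.
  by move=> f /andP[_ /eqP fi]; apply/ffunP=> i;
    rewrite !updateE; case: eqP => // ->.
apply: eq_bigl => f.
rewrite updateE !eqxx andbT; apply/andP/familyP => /= [[Pkf fk0] i | Pf].
  have := familyP Pkf i; rewrite updateE !inE.
  by case: eqP => // -> _; rewrite (negbTE nri) -(eqP fk0) updateE eqxx inE eqxx.
split; [apply/familyP | apply/eqP/ffunP] => i; have := Pf i.
  by rewrite updateE !inE; case: eqP => // ->.
by rewrite !updateE; case: eqP => // ->; rewrite (negbTE nri) inE => /eqP.
Qed.

(** The sum factors over the points [k], with one term for [k] in [S] and one for [k] outside; a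
    point of [B] outside [U] contributes the factor -1 + 1 = 0. *)
Lemma sum_sign_interval (R : comPzRingType) (I : finType) (U B : {set I}) :
  U \subset B ->
  \sum_(S : {set I} | (U \subset S) && (S \subset B)) (-1) ^+ #|S| =
  (-1) ^+ #|B| *+ (U == B) :> R.
Proof.
move=> sUB.
transitivity (\prod_(k : I) (- (k \in B)%:R + (k \notin U)%:R) : R).
  rewrite bigA_distr big_mkcond; apply: eq_big => // S _.
  case: ifPn => [/andP[/subsetP sUS /subsetP sSB] |].
    rewrite -prodr_const big_mkcond; apply: eq_bigr => k _.
    case: ifPn => [/sSB -> // | /(contra (sUS k)) -> //].
  rewrite negb_and => /orP[] /subsetPn[k kin kout]; rewrite (bigD1 k) //=.
    by rewrite (negbTE kout) kin mul0r.
  by rewrite kin (negbTE kout) oppr0 mul0r.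
have [<- | neqUB] := eqVneq U B.
  rewrite mulr1n -prodr_const [RHS]big_mkcond; apply: eq_bigr => k _.
  by case: ifPn => _; rewrite ?addr0 ?oppr0 ?add0r.
have /subsetPn[k kB kU] : ~~ (B \subset U).
  by apply: contra neqUB => sBU; rewrite eqEsubset sUB.
by rewrite (bigD1 k) //= kB kU addNr mul0r.
Qed.

Lemma big_powersetU (I : finType) (V : nmodType) (B C : {set I})
    (g : {set I} -> V) :
  [disjoint B & C] ->
  \sum_(S in powerset (B :|: C)) g S =
  \sum_(T in powerset C) \sum_(S in powerset B) g (S :|: T).
Proof.
move=> dBC; rewrite pair_big /=.
rewrite (reindex_onto (fun u : {set I} * {set I} => u.2 :|: u.1)
           (fun S => (S :&: C, S :&: B))) /=; last first.
  by move=> S; rewrite powersetE => sS; rewrite -setIUr; apply/setIidPl.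
apply: eq_bigl => -[T S]; rewrite !powersetE /=.
apply/andP/andP => [[sU /eqP[<- <-]] | [sT sS]]; first by rewrite !subsetIr.
split; first by rewrite setUSS.
rewrite !setIUl (setIidPl sS) (setIidPl sT).
have -> : S :&: C = set0 by apply: disjoint_setI0; apply: disjointWl sS dBC.
have -> : T :&: B = set0.
  by apply: disjoint_setI0; rewrite disjoint_sym in dBC; apply: disjointWl sT dBC.
by rewrite set0U setU0.
Qed.

Section Polarization.
Variables (K : fieldType) (G F : lmodType K).

Lemma multilinear_sum n (A : {ffun 'I_n -> G} -> F) (I : finType) (k0 : I)
    (Q : pred I) (y : I -> G) :
  multilinear A ->
  A [ffun=> \sum_(k | Q k) y k] =
  \sum_(f : {ffun 'I_n -> I} | f \in ffun_on Q) A [ffun i => y (f i)].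
Proof.
move=> linA; pose s := \sum_(k | Q k) y k.
(* The list [r] holds the slots already expanded; the others still contain [s]. *)
suff expand (r : seq 'I_n) : uniq r ->
    A [ffun=> s] = \sum_(f in pfamily k0 (mem r) (fun=> Q))
      A [ffun i => if i \in r then y (f i) else s].
  rewrite (expand _ (enum_uniq 'I_n)); apply: eq_big => [f | f _].
    apply/familyP/ffun_onP => Pf i;
      by have := Pf i; rewrite mem_enum.
  by congr A; apply/ffunP => i; rewrite !ffunE mem_enum.
elim: r => [_ | i0 r IHr /= /andP[nri /IHr ->]].
  rewrite (big_pred1 [ffun=> k0]) //= => f.
  apply/familyP/eqP => [Pf | -> i]; last by rewrite ffunE !inE.
  by apply/ffunP => i; rewrite ffunE; apply/eqP; have := Pf i; rewrite !inE.
rewrite big_pfamily_cons //; apply: eq_bigr => f _.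
pose x := [ffun i => if i \in r then y (f i) else s].
pose L := HB.pack_for {linear G -> F} (fun t => A (update x i0 t))
  (GRing.isLinear.Build K G F _ (fun t => A (update x i0 t)) (linA i0 x)).
have -> : A [ffun i => if i \in r then y (f i) else s] = L s.
  by congr A; apply/ffunP => i; rewrite updateE !ffunE;
    case: eqP nri => // -> /negbTE ->.
rewrite linear_sum; apply: eq_bigr => k _.
congr A; apply/ffunP => i; rewrite !ffunE /= !ffunE /= inE.
by case: (eqVneq i i0) => // ->; case: ifP.
Qed.

Definition polar (I : finType) (B : {set I}) (Q : G -> F) (y : I -> G) : F :=
  \sum_(S in powerset B) (-1) ^+ #|S| *: Q (\sum_(k in S) y k).

(** After exchanging sums, [f] carries the signed count of the sets between its image and [B], which
    vanishes unless [f] is onto [B]; with [#|B|] slots, onto means injective. *)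
Lemma polar_expand (I : finType) (B : {set I}) (A : {ffun 'I_#|B| -> G} -> F)
    (y : I -> G) :
  multilinear A -> (0 < #|B|)%N ->
  polar B (fun x => A [ffun=> x]) y =
  (-1) ^+ #|B| *:
    \sum_(f : {ffun 'I_#|B| -> I} | (f \in ffun_on (mem B)) && injectiveb f)
      A [ffun i => y (f i)].
Proof.
move=> linA /card_gt0P[k0 _].
pose img (f : {ffun 'I_#|B| -> I}) := [set f i | i in 'I_#|B|].
have imgP f (S : {set I}) : (f \in ffun_on (mem S)) = (img f \subset S).
  apply/ffun_onP/subsetP => [fS _ /imsetP[i _ ->] | fS i]; first exact: fS.
  exact/fS/imset_f.
rewrite /polar; under eq_bigr => S _.
  rewrite (multilinear_sum k0 (mem S)) // scaler_sumr.
  over.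
rewrite (exchange_big_dep (fun f => f \in ffun_on (mem B))) /=; last first.
  by move=> S f; rewrite powersetE !imgP => sSB /subset_trans; apply.
rewrite big_mkcondr scaler_sumr; apply: eq_bigr => f fB.
rewrite -scaler_suml; under eq_bigl do rewrite powersetE andbC imgP.
rewrite sum_sign_interval -?imgP // -scalerMnl.
suff -> : (img f == B) = injectiveb f by case: ifP; rewrite ?scaler0.
rewrite eqEcard -imgP fB /=.
have := leq_imset_card f 'I_#|B|.
rewrite -/(img f) card_ord => le_img.
apply/idP/injectiveP => [ge_img | /card_imset injf].
  have /imset_injP injf : #|img f| == #|'I_#|B| : {pred _}|.
    by rewrite card_ord eqn_leq le_img.
  by move=> i j; apply: injf.
by rewrite /img injf card_ord.
Qed.

(** Each bijection in the expansion places [k0] in exactly one slot, where [A] is linear. *)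
Lemma polar_linear (I : finType) (B : {set I}) (Q : G -> F) (y : I -> G) k0 :
  homogeneous_polynomial #|B| Q -> k0 \in B ->
  linear (fun t => polar B Q [eta y with k0 |-> t]).
Proof.
move=> [A linA QA] k0B a u v.
have B_gt0 : (0 < #|B|)%N by apply/card_gt0P; exists k0.
have E t : polar B Q [eta y with k0 |-> t] =
    polar B (fun x => A [ffun=> x]) [eta y with k0 |-> t].
  by apply: eq_bigr => S _; rewrite QA.
rewrite !E !polar_expand // scalerA mulrC -scalerA -scalerDr; congr (_ *: _).
rewrite scaler_sumr -big_split; apply: eq_bigr => f /andP[/ffun_onP fB].
move=> /injectiveP injf.
have [i0 fi0] : exists i0, f i0 = k0.
  have : k0 \in [set f i | i in 'I_#|B|].
    suff -> : [set f i | i in 'I_#|B|] = B by [].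
    apply/eqP; rewrite eqEcard (card_imset _ injf) card_ord leqnn andbT.
    by apply/subsetP => _ /imsetP[i _ ->]; exact: fB.
  by case/imsetP => i _ ->; exists i.
have slot t : [ffun i => [eta y with k0 |-> t] (f i)] =
    update [ffun i => y (f i)] i0 t.
  by apply/ffunP => i; rewrite updateE !ffunE /= -fi0 (inj_eq injf).
by rewrite !slot linA.
Qed.

Lemma polar_diag (I : finType) (B : {set I}) (Q : G -> F) (x : G) :
  homogeneous_polynomial #|B| Q -> (0 < #|B|)%N ->
  polar B Q (fun=> x) = ((-1) ^+ #|B| * (#|B|`!)%:R) *: Q x.
Proof.
move=> [A linA QA] B_gt0.
transitivity (polar B (fun x => A [ffun=> x]) (fun=> x)).
  by apply: eq_bigr => S _; rewrite QA.
rewrite polar_expand // -scalerA QA; congr (_ *: _).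
rewrite sumr_const scaler_nat; congr (_ *+ _).
have := card_inj_ffuns_on 'I_#|B| (mem B).
by rewrite card_ord ffactnn cardsE => <-.
Qed.

End Polarization.

Section BlockPolarization.
Variables (K : fieldType) (E F : lmodType K) (m : nat) (I : finType).
Variables (p : I -> 'I_m) (P : {ffun 'I_m -> E} -> F).

(** [J] is the set of coordinates being polarized, so that they can be treated one at a time; [p]
    sends an index to its block. *)
Definition block_sums (J : {set 'I_m}) (w : {ffun 'I_m -> E})
    (X : I -> {ffun 'I_m -> E}) (S : {set I}) : {ffun 'I_m -> E} :=
  [ffun j => if j \in J then \sum_(k in S | p k == j) X k j else w j].

Definition block_polar (J : {set 'I_m}) (w : {ffun 'I_m -> E})
    (X : I -> {ffun 'I_m -> E}) : F :=
  \sum_(S in powerset (p @^-1: J)) (-1) ^+ #|S| *: P (block_sums J w X S).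

(** A set of indices splits into its part in block [j0], which affects only coordinate [j0], and the
    rest; the sign is multiplicative. *)
Lemma block_polarU1 (j0 : 'I_m) (J : {set 'I_m}) w X :
  j0 \notin J ->
  block_polar (j0 |: J) w X =
  \sum_(S in powerset (p @^-1: J)) (-1) ^+ #|S| *:
    polar (p @^-1: [set j0]) (fun t => P (update (block_sums J w X S) j0 t))
      (fun k => X k j0).
Proof.
move=> j0J; rewrite /block_polar preimsetU big_powersetU; last first.
  rewrite -setI_eq0 -preimsetI; suff /eqP -> : [set j0] :&: J == set0.
    by rewrite preimset0.
  by rewrite setI_eq0 disjoints1.
apply: eq_bigr => T; rewrite powersetE => /subsetP sT.
rewrite /polar scaler_sumr; apply: eq_bigr => S; rewrite powersetE => /subsetP sS.
have dST k : k \in S -> k \notin T.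
  move=> /sS; rewrite !inE => /eqP pk; apply: contra j0J => /sT.
  by rewrite inE pk.
rewrite scalerA -exprD; congr (_ ^+ _ *: P _).
  rewrite cardsU addnC; suff -> : S :&: T = set0 by rewrite cards0 subn0.
  by apply/setP => k; rewrite !inE; apply/andP => -[/dST/negP].
apply/ffunP => j; rewrite !ffunE /= ffunE !inE.
have [-> | neq_j] := eqVneq j j0.
  apply: eq_bigl => k; rewrite inE; case: (boolP (k \in S)) => /= [/sS | _].
    by rewrite !inE.
  by apply/andP => -[/sT]; rewrite inE => pkJ /eqP pk; rewrite -pk pkJ in j0J.
rewrite /=; case: ifP => // _; apply: eq_bigl => k; rewrite inE.
case: (boolP (k \in S)) => //= kS; rewrite (negbTE (dST k kS)) /=.
by have := sS k kS; rewrite !inE => /eqP ->; rewrite eq_sym (negbTE neq_j).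
Qed.

Variable n : 'I_m -> nat.
Hypothesis card_block : forall j, #|p @^-1: [set j]| = n j.
Hypothesis P_multi : multipolynomial n P.

Lemma block_polar_linear w X k0 :
  linear (fun t => block_polar setT w [eta X with k0 |-> t]).
Proof.
move=> a u v; rewrite -(setUCr [set p k0]).
rewrite !block_polarU1 ?inE ?eqxx // scaler_sumr -big_split.
apply: eq_bigr => S; rewrite powersetE => /subsetP sS /=.
(* The sums over the other blocks therefore do not see [X k0]. *)
have k0S : k0 \notin S by apply/negP => /sS; rewrite !inE eqxx.
have base t : block_sums (~: [set p k0]) w [eta X with k0 |-> t] S =
    block_sums (~: [set p k0]) w X S.
  apply/ffunP => j; rewrite !ffunE; case: ifP => // _.
  apply: eq_bigr => k /andP[kS _] /=.
  by case: eqP kS k0S => // -> ->.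
rewrite !base; set z := block_sums _ _ _ _.
pose Q t := P (update z (p k0) t).
have slot t : polar (p @^-1: [set p k0]) Q
      (fun k => [eta X with k0 |-> t] k (p k0)) =
    polar (p @^-1: [set p k0]) Q
      [eta (fun k => X k (p k0)) with k0 |-> t (p k0)].
  apply: eq_bigr => T _; congr (_ *: Q _); apply: eq_bigr => k _ /=.
  by case: eqP.
have homQ : homogeneous_polynomial #|p @^-1: [set p k0]| Q.
  by rewrite card_block; apply: P_multi.
have k0B : k0 \in p @^-1: [set p k0] by rewrite !inE.
rewrite -/Q !slot !ffunE (polar_linear _ homQ k0B).
by rewrite scalerDr !scalerA mulrC.
Qed.

Lemma block_polar_diag (J : {set 'I_m}) x :
  (forall j, 0 < n j)%N ->
  block_polar J x (fun=> x) =
  (\prod_(j in J) ((-1) ^+ n j * (n j)`!%:R)) *: P x.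
Proof.
move=> n_gt0; have [N] := ubnP #|J|; elim: N J => // N IHN J.
have [-> _ | [j0 j0J]] := set_0Vmem J.
  rewrite big_set0 scale1r /block_polar preimset0 powerset0 big_set1.
  rewrite cards0 scale1r; congr P; apply/ffunP => j.
  by rewrite ffunE inE.
rewrite (cardsD1 j0) j0J ltnS => /IHN IHJ.
have j0J' : j0 \notin J :\ j0 by rewrite !inE eqxx.
rewrite -(setD1K j0J) block_polarU1 // big_setU1 //= -scalerA -IHJ.
rewrite /block_polar scaler_sumr; apply: eq_bigr => S _.
rewrite polar_diag ?card_block //.
rewrite !scalerA mulrC; congr (_ *: P _).
(* Coordinate [j0], being outside [J :\ j0], already has the value [x j0]. *)
by apply/ffunP => j; rewrite updateE !ffunE; case: eqP => // ->;
  rewrite (negbTE j0J').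
Qed.

End BlockPolarization.

(** [tagnat] cuts the indices below the sum of the [n j] into blocks; [tagnat.Rank j] enumerates
    block [j] injectively. *)
Lemma card_sig1_preim m (n : 'I_m -> nat) j :
  #|(@tagnat.sig1 m n) @^-1: [set j]| = n j.
Proof.
have -> : (@tagnat.sig1 m n) @^-1: [set j] = [set tagnat.Rank j i | i in 'I_(n j)].
  apply/setP => k; rewrite !inE; apply/eqP/imsetP => [<- | [i _ ->]].
    by exists (tagnat.sig2 k); rewrite ?tagnat.sig2K.
  exact: tagnat.Rank1K.
rewrite card_imset ?card_ord // => i i' /(congr1 (@nat_of_ord _)) /eqP.
by rewrite tagnat.eq_Rank eqxx => /eqP /val_inj.
Qed.

Lemma multipolynomial_homogeneous (K : fieldType) (E F : lmodType K) (m : nat)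
    (n : 'I_m -> nat) (P : {ffun 'I_m -> E} -> F) :
  [pchar K] =i pred0 -> (forall j, 0 < n j)%N -> multipolynomial n P ->
  homogeneous_polynomial (\sum_(j < m) n j)%N P.
Proof.
move=> charK n_gt0 P_multi.
pose c : K := \prod_(j in [set: 'I_m]) ((-1) ^+ n j * (n j)`!%:R).
pose p := @tagnat.sig1 m n.
have c_neq0 : c != 0.
  apply/prodf_neq0 => j _; rewrite mulf_neq0 ?signr_eq0 //.
  by have /pcharf0P -> := charK; rewrite -lt0n fact_gt0.
exists (fun X => c^-1 *: block_polar p P setT 0 X) => [k0 X a u v | x].
  have upd t : block_polar p P setT 0 (update X k0 t) =
      block_polar p P setT 0 [eta X with k0 |-> t].
    apply: eq_bigr => S _; congr (_ *: P _); apply/ffunP => j.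
    by rewrite !ffunE; case: ifP => // _; apply: eq_bigr => k _; rewrite ffunE.
  rewrite !upd (block_polar_linear (@card_sig1_preim m n) P_multi).
  by rewrite scalerDr !scalerA mulrC.
(* With every coordinate polarized, the base point 0 may be replaced by [x], as [block_polar_diag]
   expects. *)
have -> : block_polar p P setT 0 [ffun=> x] = block_polar p P setT x (fun=> x).
  apply: eq_bigr => S _; congr (_ *: P _); apply/ffunP => j.
  by rewrite !ffunE inE; apply: eq_bigr => k _; rewrite ffunE.
rewrite (block_polar_diag (@card_sig1_preim m n) P_multi) //.
by rewrite scalerA mulVf ?scale1r.
Qed.

Theorem corollary2p2 (R : realType) (K : fieldType)
    (hK : K = R :> fieldType \/ K = R[i]%C :> fieldType)
    (E F : lmodType K) (m : nat) (n : 'I_m -> nat)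
    (hm : (0 < m)%N) (hn : forall j : 'I_m, (0 < n j)%N)
    (P : {ffun 'I_m -> E} -> F) :
  multipolynomial n P ->
  homogeneous_polynomial (\sum_(j < m) n j)%N P.
Proof.
apply: multipolynomial_homogeneous => //.
by case: hK => ->; apply: Num.Theory.pchar_num.
Qed.
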